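(* Let $n\ge1$. In the space $\Omega(x_1,x_2,\cdots,x_n)=\{\mathcal{A}(t_1,t_2,\cdots,t_n)\mid t_i\in\Bbbk,\ i=1,2,\cdots,n\}$ there are only two isomorphism classes of DG algebras, namely those of $\mathcal{A}(0,0,\cdots,0)$ and $\mathcal{A}(1,0,\cdots,0)$.
   Context: $\Bbbk$ is an algebraically closed field of characteristic $0$. A cochain DG algebra is a graded $\Bbbk$-algebra $\mathcal{A}$ with a $\Bbbk$-linear differential $\partial_{\mathcal{A}}$ of degree $1$, $\partial_{\mathcal{A}}^2=0$, satisfying $\partial_{\mathcal{A}}(ab)=(\partial_{\mathcal{A}}a)b+(-1)^{|a|}a(\partial_{\mathcal{A}}b)$ for all homogeneous $a,b$. For $(t_1,\dots,t_n)\in\Bbbk^n$, $\mathcal{A}(t_1,\dots,t_n)$ denotes the cochain DG algebra whose underlying graded algebra is the ordinary commutative polynomial algebra $\Bbbk[x_1,\dots,x_n]$ with $|x_i|=1$ and whose differential is determined, via the Leibniz rule, by $\partial_{\mathcal{A}}(x_i)=\sum_{j=1}^{n}t_jx_ix_j$ for all $i$. A morphism of DG algebras is a chain map (of degree $0$) respecting multiplication and unit; an isomorphism of DG algebras is a bijective such morphism. *)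

(* Defs.v *)
From HB Require Import structures.
From mathcomp Require Import all_boot all_order all_algebra.
From mathcomp Require Import ssrcomplements.
From mathcomp Require Export mpoly.

Set Implicit Arguments.
Unset Strict Implicit.
Unset Printing Implicit Defensive.

Import GRing.Theory.
Local Open Scope ring_scope.

(* [dg_deg i a] means that [a] lies in the homogeneous component of degree [i];
   in particular 0 lies in every component. [dg_span] and [dg_indep] say that
   the underlying space is the direct sum of its components. *)
Record dgAlgebra (k : fieldType) := DGAlgebra {
  dg_sort :> algType k;
  dg_deg : int -> dg_sort -> Prop;
  dg_diff : {linear dg_sort -> dg_sort};
  dg_deg0 : forall i, dg_deg i 0;
  dg_degP : forall i (c : k) a b,
    dg_deg i a -> dg_deg i b -> dg_deg i (c *: a + b);
  dg_span : forall a, exists (s : seq int) (f : int -> dg_sort),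
    (forall i, dg_deg i (f i)) /\ a = \sum_(i <- s) f i;
  dg_indep : forall (s : seq int) (f : int -> dg_sort),
    uniq s -> (forall i, dg_deg i (f i)) -> \sum_(i <- s) f i = 0 ->
    forall i, i \in s -> f i = 0;
  dg_deg1 : dg_deg 0 1;
  dg_degM : forall i j a b,
    dg_deg i a -> dg_deg j b -> dg_deg (i + j) (a * b);
  dg_diff_deg : forall i a, dg_deg i a -> dg_deg (i + 1) (dg_diff a);
  dg_diff_sq : forall a, dg_diff (dg_diff a) = 0;
  dg_leibniz : forall i j a b, dg_deg i a -> dg_deg j b ->
    dg_diff (a * b) = dg_diff a * b + (-1) ^+ `|i|%N * (a * dg_diff b)
}.

Arguments dg_deg {k A} i a : rename.
Arguments dg_diff {k A} : rename.

Record dgMorphism (k : fieldType) (A B : dgAlgebra k) := DGMorphism {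
  dgm_fun :> {lrmorphism A -> B};
  dgm_deg : forall i (a : A), dg_deg i a -> dg_deg i (dgm_fun a);
  dgm_diff : forall a : A, dgm_fun (dg_diff a) = dg_diff (dgm_fun a)
}.

Definition dg_iso (k : fieldType) (A B : dgAlgebra k) : Prop :=
  exists f : dgMorphism A B, bijective f.

Section PolyDG.

Variables (k : fieldType) (n : nat) (t : 'rV[k]_n).

Implicit Types (p q : {mpoly k[n]}) (w : seq 'I_n) (m : 'X_{1..n}).

Definition poly_deg (i : int) p : Prop :=
  match i with
  | Posz d => p \is d.-homog
  | Negz _ => p = 0
  end.

Definition gen_diff (i : 'I_n) : {mpoly k[n]} :=
  \sum_(j < n) t 0 j *: ('X_i * 'X_j).

Definition word_mon w : {mpoly k[n]} := \prod_(i <- w) 'X_i.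

(* The differential of x_(i_1) ... x_(i_d), computed from [gen_diff] by the
   Leibniz rule d(x_i v) = d(x_i) v - x_i d(v). *)
Fixpoint word_diff w : {mpoly k[n]} :=
  if w is i :: w' then gen_diff i * word_mon w' - 'X_i * word_diff w' else 0.

(* The sorted word x_0 ... x_0 x_1 ... x_1 ... representing the monomial [m]. *)
Definition mnm_word m : seq 'I_n :=
  flatten [seq nseq (m i) i | i <- enum 'I_n].

Definition poly_diff p : {mpoly k[n]} :=
  \sum_(m <- msupp p) p@_m *: word_diff (mnm_word m).

Lemma poly_diff_is_linear : linear poly_diff.
Proof.
have E l p : (msize p <= l)%N -> poly_diff p =
    \sum_(m : 'X_{1..n < l}) p@_m *: word_diff (mnm_word m).
  move=> le_pl; pose I : subFinType _ := 'X_{1..n < l}.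
  rewrite /poly_diff (big_mksub I) //=; first last.
  + by move=> x /msize_mdeg_lt /leq_trans; apply.
  + by rewrite msupp_uniq.
  by rewrite big_rmcond //= => i; move/memN_msupp_eq0 ->; rewrite scale0r.
move=> c p q; pose l := maxn (msize (c *: p + q)) (maxn (msize p) (msize q)).
rewrite !(E l) ?leq_max ?leqnn ?orbT // scaler_sumr -big_split /=.
by apply: eq_bigr => m _; rewrite mcoeffD mcoeffZ scalerDl scalerA.
Qed.

HB.instance Definition _ :=
  GRing.isLinear.Build k {mpoly k[n]} {mpoly k[n]} _ poly_diff
    poly_diff_is_linear.

Let L : {mpoly k[n]} := \sum_(j < n) t 0 j *: 'X_j.

Lemma gen_diffE i : gen_diff i = L * 'X_i.
Proof.
rewrite /gen_diff /L mulr_suml; apply: eq_bigr => j _.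
by rewrite -scalerAl mulrC.
Qed.

Lemma word_diffE w :
  word_diff w = if odd (size w) then L * word_mon w else 0.
Proof.
elim: w => //= i w ->; rewrite gen_diffE /word_mon big_cons.
case: (odd _) => /=; last by rewrite mulr0 subr0 mulrA.
by rewrite mulrCA mulrA subrr.
Qed.

Lemma mnm_wordE m : word_mon (mnm_word m) = 'X_[m].
Proof.
rewrite /word_mon big_flatten big_map big_enum /= mpolyXE_id.
by apply: eq_bigr => i _; rewrite big_nseq -Monoid.iteropE.
Qed.

Lemma size_mnm_word m : size (mnm_word m) = mdeg m.
Proof.
rewrite size_flatten /shape -map_comp sumnE big_map big_enum /= mdegE.
by apply: eq_bigr => i _; rewrite /= size_nseq.
Qed.

Lemma poly_diff_homog d p :
  p \is d.-homog -> poly_diff p = if odd d then L * p else 0.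
Proof.
move=> /dhomogP hp; rewrite /poly_diff.
rewrite (eq_big_seq (fun m => p@_m *: (if odd d then L * 'X_[m] else 0))).
  case: (odd d); last by rewrite big1 // => m _; rewrite scaler0.
  rewrite [in RHS](mpolyE p) mulr_sumr; apply: eq_bigr => m _.
  by rewrite scalerAr.
by move=> m /hp /= Em; rewrite word_diffE size_mnm_word Em mnm_wordE.
Qed.

Lemma poly_diffX (i : 'I_n) :
  poly_diff 'X_i = \sum_(j < n) t 0 j *: ('X_i * 'X_j).
Proof.
have hX : 'X_i \is [in k[n], 1.-homog] by rewrite dhomogX /= mdeg1.
by rewrite (poly_diff_homog hX) /= -gen_diffE.
Qed.

Lemma linform_homog : L \is 1.-homog.
Proof. by apply: rpred_sum => j _; rewrite rpredZ // dhomogX /= mdeg1. Qed.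

Lemma poly_deg0 i : poly_deg i 0.
Proof. by case: i => d //=; exact: dhomog0. Qed.

Lemma poly_degP i (c : k) p q :
  poly_deg i p -> poly_deg i q -> poly_deg i (c *: p + q).
Proof.
case: i => d /= => [hp hq|-> ->]; last by rewrite scaler0 addr0.
by rewrite rpredD // rpredZ.
Qed.

Lemma poly_span p : exists (s : seq int) (f : int -> {mpoly k[n]}),
  (forall i, poly_deg i (f i)) /\ p = \sum_(i <- s) f i.
Proof.
exists [seq Posz d | d <- iota 0 (msize p)].
exists (fun i => if i is Posz d then pihomog mdeg d p else 0); split.
  by case=> d //=; exact: pihomogP.
rewrite big_map {1}(@pihomog_partitionE _ _ mdeg (msize p) p) //.
by rewrite -(big_mkord xpredT (fun d => pihomog mdeg d p)) /index_iota subn0.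
Qed.

Lemma poly_indep (s : seq int) (f : int -> {mpoly k[n]}) :
  uniq s -> (forall i, poly_deg i (f i)) -> \sum_(i <- s) f i = 0 ->
  forall i, i \in s -> f i = 0.
Proof.
move=> us hf s0 [d|d] ds; last exact: (hf (Negz d)).
have := congr1 (pihomog mdeg d) s0; rewrite linear0 linear_sum /=.
rewrite (bigD1_seq (Posz d)) //= big1 ?addr0; last first.
  case=> e ne; last by rewrite (hf (Negz e)) linear0.
  by apply: pihomog_ne0 (hf (Posz e)); apply: contraNneq ne => ->.
by rewrite (pihomog_dE (hf (Posz d))).
Qed.

Lemma poly_deg1 : poly_deg 0 1.
Proof. exact: dhomog1. Qed.

Lemma poly_degM i j p q :
  poly_deg i p -> poly_deg j q -> poly_deg (i + j) (p * q).
Proof.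
case: i => d; last by move=> -> _; rewrite mul0r; exact: poly_deg0.
case: j => e; last by move=> _ ->; rewrite mulr0; exact: poly_deg0.
exact: dhomogM.
Qed.

Lemma poly_diff_deg i p : poly_deg i p -> poly_deg (i + 1) (poly_diff p).
Proof.
case: i => d; last by move=> ->; rewrite linear0; exact: poly_deg0.
move=> /= hp; rewrite (poly_diff_homog hp) addnC.
by case: (odd d); [exact: dhomogM linform_homog hp | exact: dhomog0].
Qed.

Lemma poly_diff_sq p : poly_diff (poly_diff p) = 0.
Proof.
have E m : poly_diff (poly_diff 'X_[m]) = 0.
  have hm : 'X_[m] \is [in k[n], (mdeg m).-homog] by rewrite dhomogX.
  rewrite (poly_diff_homog hm); case: ifP => om; last by rewrite linear0.
  by rewrite (poly_diff_homog (dhomogM linform_homog hm)) /= om.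
elim/mpolyind: p => [|c m p _ _ IH]; first by rewrite !linear0.
by rewrite !linearP /= E IH scaler0 addr0.
Qed.

Lemma poly_leibniz i j p q : poly_deg i p -> poly_deg j q ->
  poly_diff (p * q) = poly_diff p * q + (-1) ^+ `|i|%N * (p * poly_diff q).
Proof.
case: i => d; last by move=> -> _; rewrite !(linear0, mul0r, mulr0) addr0.
case: j => e; last by move=> _ ->; rewrite !(linear0, mul0r, mulr0) addr0.
move=> /= hp hq; rewrite (poly_diff_homog (dhomogM hp hq)).
rewrite (poly_diff_homog hp) (poly_diff_homog hq) oddD -signr_odd.
case: (odd d); case: (odd e) => /=;
  rewrite ?mulr0 ?mul0r ?addr0 ?add0r ?expr0 ?expr1 ?mul1r ?mulN1r ?mulrA //.
  by rewrite [p * L]mulrC subrr.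
by rewrite [p * L]mulrC.
Qed.

(* The DG algebra A(t_1, ..., t_n); its variables are 'X_0, ..., 'X_(n-1). *)
Definition polyDG : dgAlgebra k :=
  @DGAlgebra k {mpoly k[n]} poly_deg poly_diff
    poly_deg0 poly_degP poly_span poly_indep poly_deg1 poly_degM
    poly_diff_deg poly_diff_sq poly_leibniz.

(* The differential is determined by its values on the variables. *)
Lemma poly_diff_unique (d : {linear {mpoly k[n]} -> {mpoly k[n]}}) :
  (forall i j p q, poly_deg i p -> poly_deg j q ->
     d (p * q) = d p * q + (-1) ^+ `|i|%N * (p * d q)) ->
  (forall i, d 'X_i = \sum_(j < n) t 0 j *: ('X_i * 'X_j)) ->
  d =1 poly_diff.
Proof.
move=> dM dX p; rewrite {1}[p]mpolyE linear_sum; apply: eq_bigr => m _.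
rewrite linearZ /=; congr (_ *: _); rewrite -mnm_wordE.
have d1 : d 1 = 0.
  have := dM 0 0 1 1 poly_deg1 poly_deg1.
  rewrite expr0 !(mul1r, mulr1) => e.
  by apply: (addrI (d 1)); rewrite -e addr0.
have hX i : poly_deg 1 'X_i by rewrite /= dhomogX /= mdeg1.
elim: (mnm_word m) => [|i w IH]; first by rewrite /word_mon big_nil d1.
have hw : poly_deg (size w) (word_mon w).
  elim: w {IH} => [|i' w IH]; first by rewrite /word_mon big_nil; exact: dhomog1.
  by rewrite /word_mon big_cons; exact: (poly_degM (hX i') IH).
rewrite /word_mon big_cons -/(word_mon w) (dM _ _ _ _ (hX i) hw) dX IH.
by rewrite expr1 mulN1r.
Qed.

End PolyDG.

(* Main.v *)
Require Import Defs.
From mathcomp Require Import all_boot all_order all_algebra mpoly.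

Import GRing.Theory.
Local Open Scope ring_scope.

(** Writing [L_t] for the linear form [\sum_j t_j x_j], the differential of
    A(t) sends [p] homogeneous of degree [d] to [L_t * p] if [d] is odd and to
    0 otherwise. Hence an invertible linear substitution mapping [L_t] to [L_s]
    is an isomorphism from A(t) to A(s), and any two nonzero linear forms are
    related by such a substitution. On the other hand the differential vanishes
    on A(0) but not on A(s) for [s] nonzero. *)

Section LinearSubstitution.

Variables (k : fieldType) (n : nat).

Implicit Types (t s : 'rV[k]_n) (M N : 'M[k]_n) (p : {mpoly k[n]}).

Definition linform t : {mpoly k[n]} := \sum_(j < n) t 0 j *: 'X_j.

(** The images of the variables are read off the rows of [M], so that substitution acts on
    coefficient rows by right multiplication. *)
Definition lin_subst M : n.-tuple {mpoly k[n]} :=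
  [tuple linform (row i M) | i < n].

Lemma linform_eq0 t : linform t = 0 -> t = 0.
Proof.
move=> Lt0; apply/rowP=> i; rewrite mxE.
have := congr1 (mcoeff U_(i)) Lt0; rewrite mcoeff0 linear_sum /=.
rewrite (bigD1 i) //= big1 => [|j ne_ji]; last first.
  by rewrite mcoeffZ mcoeffXU (negPf ne_ji) mulr0.
by rewrite mcoeffZ mcoeffXU eqxx mulr1 addr0.
Qed.

Lemma lin_subst_linform t M :
  linform t \mPo lin_subst M = linform (t *m M).
Proof.
rewrite /linform linear_sum /=.
under eq_bigr => i _.
  rewrite comp_mpolyZ comp_mpolyXU -tnth_nth tnth_mktuple scaler_sumr; over.
rewrite exchange_big /=; apply: eq_bigr => j _.
by rewrite mxE scaler_suml; apply: eq_bigr => i _; rewrite mxE scalerA.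
Qed.

Lemma lin_subst_comp M N p :
  (p \mPo lin_subst M) \mPo lin_subst N = p \mPo lin_subst (M *m N).
Proof.
elim/mpolyind: p => [|c m p _ _ IH]; first by rewrite !linear0.
rewrite !comp_mpolyD !comp_mpolyZ IH; congr (_ *: _ + _).
rewrite !comp_mpolyX rmorph_prod /=; apply: eq_bigr => i _.
by rewrite rmorphXn /= !tnth_mktuple lin_subst_linform row_mul.
Qed.

Lemma lin_subst1 p : p \mPo lin_subst 1%:M = p.
Proof.
rewrite -[RHS]comp_mpoly_id; congr (_ \mPo _).
apply: eq_from_tnth => i; rewrite !tnth_mktuple /linform (bigD1 i) //=.
rewrite big1 => [|j ne_ji]; first by rewrite !mxE eqxx scale1r addr0.
by rewrite !mxE eq_sym (negPf ne_ji) scale0r.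
Qed.

Lemma lin_subst_bij M : M \in unitmx ->
  bijective (fun p => p \mPo lin_subst M).
Proof.
move=> uM; exists (fun p => p \mPo lin_subst (invmx M)) => p.
  by rewrite lin_subst_comp mulmxV // lin_subst1.
by rewrite lin_subst_comp mulVmx // lin_subst1.
Qed.

Lemma lin_subst_homog M d p :
  p \is d.-homog -> p \mPo lin_subst M \is d.-homog.
Proof.
move=> /dhomogP hp; rewrite comp_mpolyE big_seq.
apply: rpred_sum => m /hp /= <-; apply: rpredZ; rewrite mdegE.
elim/big_ind2: _ => [|a p1 b p2|i _]; [exact: dhomog1 | exact: dhomogM |].
by rewrite tnth_mktuple -{2}[m i]mul1n; exact/dhomogMn/linform_homog.
Qed.

(** By linearity a monomial suffices. Substitution keeps its degree, hence the parity that governs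
    both differentials, and being multiplicative it carries the factor [linform t] to
    [linform (t *m M)]. *)
Lemma lin_subst_diff t M p :
  poly_diff t p \mPo lin_subst M = poly_diff (t *m M) (p \mPo lin_subst M).
Proof.
elim/mpolyind: p => [|c m p _ _ IH]; first by rewrite !linear0.
rewrite comp_mpolyD comp_mpolyZ !linearP /= IH; congr (_ *: _ + _).
have hm : ('X_[m] : {mpoly k[n]}) \is (mdeg m).-homog by rewrite dhomogX.
rewrite (poly_diff_homog t hm) (poly_diff_homog _ (lin_subst_homog M _ _ hm)).
case: odd; last by rewrite linear0.
by rewrite rmorphM /= -/(linform t) lin_subst_linform.
Qed.

Lemma dg_iso_lin_subst t M :
  M \in unitmx -> dg_iso (polyDG t) (polyDG (t *m M)).
Proof.
move=> uM; pose f : {lrmorphism polyDG t -> polyDG (t *m M)} :=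
  comp_mpoly (lin_subst M).
have f_deg i (a : polyDG t) : dg_deg i a -> dg_deg i (f a).
  case: i => d /=; first exact: lin_subst_homog.
  by move=> ->; exact: linear0.
by exists (DGMorphism f_deg (lin_subst_diff t M)); exact: lin_subst_bij.
Qed.

Lemma unitmx_transitive t s :
  t != 0 -> s != 0 -> exists2 M : 'M[k]_n, M \in unitmx & t *m M = s.
Proof.
move=> t_neq0 s_neq0.
(* A nonzero row is row free, so [pinvmx t] is a right inverse of [t]. The matrix [pinvmx t *m s] is
   singular in general, but it preserves the rank of [t], so some invertible matrix agrees with it
   on [t]. *)
have tK : t *m (pinvmx t *m s) = s.
  by rewrite mulmxA mulmxVp ?mul1mx // /row_free rank_rV t_neq0.
have /complete_unitmx[M uM tM] : \rank (t *m (pinvmx t *m s)) = \rank t.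
  by rewrite tK !rank_rV t_neq0 s_neq0.
by exists M; rewrite // -tM.
Qed.

Lemma dg_iso_poly_neq0 t s :
  t != 0 -> s != 0 -> dg_iso (polyDG t) (polyDG s).
Proof.
move=> t0 s0; have [M uM <-] := unitmx_transitive t s t0 s0.
exact: dg_iso_lin_subst.
Qed.

Lemma poly_diff0 p : poly_diff 0 p = 0.
Proof.
elim/mpolyind: p => [|c m p _ _ IH]; first by rewrite linear0.
rewrite linearP /= IH addr0.
have hm : ('X_[m] : {mpoly k[n]}) \is (mdeg m).-homog by rewrite dhomogX.
rewrite (poly_diff_homog 0 hm) big1 => [|j _]; last by rewrite mxE scale0r.
by rewrite mul0r if_same scaler0.
Qed.

Lemma not_dg_iso_poly0 s : s != 0 ->
  ~ dg_iso (polyDG (0 : 'rV[k]_n)) (polyDG s).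
Proof.
move=> s_neq0 [f [g _ gK]]; case/negP: s_neq0; apply/eqP/linform_eq0.
(* Surjectivity of [f] transports the zero differential to the target. *)
have diff0 (b : polyDG s) : dg_diff b = 0.
  by rewrite -[b]gK -dgm_diff [dg_diff (g b)]poly_diff0 linear0.
(* Without variables the form is an empty sum. *)
have [i _|noI] := pickP (fun i : 'I_n => true); last first.
  by rewrite /linform big1 // => i; have := noI i.
have hX : ('X_i : {mpoly k[n]}) \is 1.-homog by rewrite dhomogX /= mdeg1.
(* In odd degree 1 this reads [linform s * 'X_i = 0], and the polynomial ring is a domain. *)
have /eqP := diff0 'X_i; rewrite /= (poly_diff_homog s hX) /= mulf_eq0.
by rewrite -[X in _ || X]msize_poly_eq0 msizeX orbF => /eqP.
Qed.

End LinearSubstitution.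

Theorem corollary4p2 (k : closedFieldType) (char0 : [pchar k] =i pred0)
    (n : nat) (n_gt0 : (0 < n)%N) :
  let A000 := polyDG (0 : 'rV[k]_n) in
  let A100 := polyDG (\row_(j < n) (j == 0%N :> nat)%:R : 'rV[k]_n) in
  ~ dg_iso A000 A100 /\
  (forall t : 'rV[k]_n, dg_iso (polyDG t) A000 \/ dg_iso (polyDG t) A100).
Proof.
have e_neq0 : (\row_(j < n) (j == 0%N :> nat)%:R : 'rV[k]_n) != 0.
  apply/eqP => /rowP/(_ (Ordinal n_gt0)); rewrite !mxE eqxx.
  by apply/eqP; exact: oner_neq0.
split; first exact: not_dg_iso_poly0.
move=> t; have [->|t_neq0] := eqVneq t 0; last first.
  by right; exact: dg_iso_poly_neq0.
(* Reflexivity comes from substituting along the identity matrix. *)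
left; rewrite -[X in _ (polyDG X)](mulmx1 0).
by apply: dg_iso_lin_subst; exact: unitmx1.
Qed.
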